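(* Let $\mathcal{H}$ be a real Hilbert space, $A:\mathcal{H}\rightrightarrows\mathcal{H}$ a maximally monotone operator, and $B:\mathcal{H}\to\mathcal{H}$ a monotone and $\frac1\beta$-Lipschitz continuous operator with $\beta>0$. Suppose that $\mathrm{Zer}(A+B)\neq\emptyset$. Let $\gamma:[0,+\infty)\to(0,\beta)$ be locally absolutely continuous such that, for some $\delta,\varepsilon>0$, we have $\delta\le\gamma(t)\le\beta-\varepsilon$ for all $t\in[0,+\infty)$, and $\dot\gamma\in L^\infty([0,+\infty))$. Let $x_0\in\mathcal{H}$ and let $x,z:[0,+\infty)\to\mathcal{H}$ be the trajectories generated by $$z(t)=J_{\gamma(t)A}\big(x(t)-\gamma(t)Bx(t)\big),\qquad 0=\dot x(t)+x(t)-z(t)-\gamma(t)Bx(t)+\gamma(t)Bz(t),\qquad x(0)=x_0.$$ Then $x(t)$ and $z(t)$ converge weakly to an element of $\mathrm{Zer}(A+B)$ as $t\to+\infty$.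
   Context: $J_{\gamma A}=(\mathrm{Id}+\gamma A)^{-1}$ is the resolvent of $\gamma A$ (single-valued and everywhere defined for $\gamma>0$). $\mathrm{Zer}(M)=\{x\in\mathcal{H}: 0\in Mx\}$. The differential system is understood in the strong global sense: $x$ is locally absolutely continuous on $[0,+\infty)$ (i.e. on each $[0,b]$, $0<b<+\infty$, it is the integral of an integrable function $\dot x$ plus the constant $x(0)$), $z(t)$ is defined by the first equation for all $t$, the second equation holds for almost every $t\in[0,+\infty)$, and $x(0)=x_0$. Such a solution exists and is unique. *)

(* Defs.v *)
From HB Require Import structures.
From mathcomp Require Import all_boot all_order all_algebra.
From mathcomp Require Import all_classical all_reals all_analysis.
Export numFieldNormedType.Exports.

Set Implicit Arguments.
Unset Strict Implicit.
Unset Printing Implicit Defensive.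
Import Order.TTheory GRing.Theory Num.Theory.
Local Open Scope classical_set_scope.
Local Open Scope ring_scope.

(* A set-valued operator M : H ⇉ H is a function M : H -> set H, where M x u  *)
(* means that (x, u) belongs to the graph of M.                               *)
Section set_valued_operators.
Context {R : realType} {H : lmodType R}.
Implicit Types M N : H -> set H.

Definition op_id : H -> set H := fun x => [set x].

Definition op_of (f : H -> H) : H -> set H := fun x => [set f x].

Definition op_scale (c : R) M : H -> set H :=
  fun x => [set c *: u | u in M x].

Definition op_add M N : H -> set H :=
  fun x => [set u + v | u in M x & v in N x].

Definition op_inv M : H -> set H := fun u => [set x | M x u].

Definition Zer M : set H := [set x | M x 0].

Definition resolvent (c : R) M : H -> set H :=
  op_inv (op_add op_id (op_scale c M)).

Context (ip : {dot H for idfun}).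

Definition monotone_op M : Prop :=
  forall x y u v, M x u -> M y v -> 0 <= ip (x - y) (u - v).

Definition maximally_monotone_op M : Prop :=
  monotone_op M /\
  forall N, monotone_op N -> (forall x, M x `<=` N x) -> forall x, N x `<=` M x.

Definition weakly_cvg_at_infty (x : R -> H) (p : H) : Prop :=
  forall v, ip (x t) v @[t --> +oo] --> ip p v.

End set_valued_operators.

Section bochner.
Context d (T : measurableType d) (R : realType) (V : normedModType R).
Variables (mu : {measure set T -> \bar R}) (D : set T).
Implicit Types (s f : T -> V).

Definition simple_on s : Prop :=
  [/\ finite_set (s @` D),
      forall v, measurable (D `&` s @^-1` [set v]) &
      forall v, v != 0 -> (mu (D `&` s @^-1` [set v]) < +oo)%E].

(* The value v = 0, whose level set may have infinite measure, contributes 0. *)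
Definition simple_integral s : V :=
  \sum_(v \in s @` D) fine (mu (D `&` s @^-1` [set v])) *: v.

(* f is Bochner integrable on D with integral I.  The almost everywhere       *)
(* convergence of the simple functions s n is the strong measurability of f;  *)
(* it cannot be dropped, since the library's integral of a nonnegative        *)
(* function is also defined (as a lower integral) for nonmeasurable ones.     *)
Definition is_bochner_integral f (I : V) : Prop :=
  exists s : nat -> T -> V,
    [/\ forall n, simple_on (s n),
        {ae mu, forall t, D t -> s n t @[n --> \oo] --> f t},
        (\int[mu]_(t in D) (`|f t - s n t|)%:E)%E @[n --> \oo] --> 0%E &
        simple_integral (s n) @[n --> \oo] --> I].

End bochner.

(* Functions on [0, +oo) are represented by total functions on R, of which    *)
(* only the values at t >= 0 matter.  The derivative df of a locally          *)
(* absolutely continuous f is the integrable density in                       *)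
(* f t = f 0 + \int_0^t df, hence unique up to a null set.                    *)
Section locally_absolutely_continuous.
Context {R : realType}.
Local Notation mu := (@lebesgue_measure R).

Definition loc_abs_cont {V : completeNormedModType R} (f df : R -> V) : Prop :=
  forall t : R, 0 <= t -> is_bochner_integral mu `[0, t] df (f t - f 0).

Definition real_loc_abs_cont (f df : R -> R) : Prop :=
  forall t : R, 0 <= t ->
    mu.-integrable `[0, t] (EFin \o df) /\
    f t = f 0 + \int[mu]_(s in `[0, t]) df s.

End locally_absolutely_continuous.

(* Main.v *)
Require Import Defs.
From mathcomp Require Import all_boot all_order all_algebra.
From mathcomp Require Import all_classical all_reals all_analysis.
From mathcomp Require Import measurable_realfun ess_sup_inf lra ring.
Set Implicit Arguments.
Unset Strict Implicit.
Unset Printing Implicit Defensive.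
Import Order.TTheory GRing.Theory Num.Theory.
Local Open Scope classical_set_scope.
Local Open Scope ring_scope.

(* For p in Zer(A+B) put w = |x - z|.  Monotonicity of A and B gives
   <dx, x - p> <= - (1 - gamma / beta) w^2, so |x - p| is nonincreasing and drops
   at a definite rate as long as w stays away from 0; since gamma is Lipschitz
   and the resolvent depends on its parameters in a Lipschitz way, w is
   Lipschitz, hence w tends to 0.  Differentiation is avoided: increments of x
   are paired with a fixed vector, which turns the Bochner integral into a real
   Lebesgue integral, and the error made by freezing the vector is of second
   order, so it vanishes under subdivision.

   Weak limits are taken along ultrafilters refining t -> +oo, where bounded
   trajectories converge weakly by Riesz representation.  Such a limit lies in
   Zer(A+B), and Opial's argument shows that it does not depend on the
   ultrafilter. *)

(** * Real Hilbert spaces: Riesz representation and weak limits along ultrafilters *)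

Section hilbert.
Context {R : realType} {H : completeNormedModType R} (ip : {dot H for idfun}).
Hypothesis hip : forall u : H, `|u| ^+ 2 = ip u u.
Implicit Types (u v w : H) (a : R).

Lemma ipC u v : ip u v = ip v u.
Proof. by rewrite hermC expr0 mul1r. Qed.

Lemma ipDl u v w : ip (u + v) w = ip u w + ip v w.
Proof. exact: linearDl. Qed.

Lemma ipDr u v w : ip u (v + w) = ip u v + ip u w.
Proof. exact: linearDr. Qed.

Lemma ipNl u v : ip (- u) v = - ip u v.
Proof. exact: linearNl. Qed.

Lemma ipNr u v : ip u (- v) = - ip u v.
Proof. exact: linearNr. Qed.

Lemma ipZl a u v : ip (a *: u) v = a * ip u v.
Proof. exact: linearZl_LR. Qed.

Lemma ipZr a u v : ip u (a *: v) = a * ip u v.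
Proof. by rewrite ipC ipZl ipC. Qed.

Definition ipE := (ipDl, ipDr, ipNl, ipNr, ipZl, ipZr).

(** Square the triangle inequality of the norm and cancel the squared norms. *)
Lemma cauchy_schwarz u v : ip u v <= `|u| * `|v|.
Proof.
have : `|u + v| ^+ 2 <= (`|u| + `|v|) ^+ 2.
  by rewrite lerXn2r ?nnegrE ?addr_ge0// ler_normD.
rewrite hip ipDl !ipDr sqrrD !hip (ipC v u); lra.
Qed.

Lemma normr_ip_le u v : `|ip u v| <= `|u| * `|v|.
Proof.
rewrite ler_norml cauchy_schwarz andbT lerNl.
by rewrite -ipNl (le_trans (cauchy_schwarz _ _))// normrN.
Qed.

Lemma cvg_ipl {T} (F : set_system T) {FF : Filter F} (f : T -> H) l v :
  f @ F --> l -> ip (f t) v @[t --> F] --> ip l v.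
Proof.
move=> /cvgrPdist_le fl; apply/cvgrPdist_le => e e0.
have e0' : 0 < e / (`|v| + 1) by rewrite divr_gt0// ltr_wpDl.
apply: filterS (fl _ e0') => t ftl.
rewrite -ipNl -ipDl (le_trans (normr_ip_le _ _))//.
rewrite (le_trans (ler_wpM2r _ ftl))// -mulrA ler_piMr ?(ltW e0)//.
by rewrite mulrC ler_pdivrMr ?ltr_wpDl// mul1r lerDl.
Qed.

(* Minimise [v |-> |v|^2 - 2 l v]; the parallelogram identity makes every
   minimising sequence Cauchy. *)
Lemma riesz_representation (l : H -> R) (M : R) :
  {morph l : u v / u + v} -> (forall a u, l (a *: u) = a * l u) ->
  (forall u, `|l u| <= M * `|u|) ->
  exists p, forall v, l v = ip p v.
Proof.
move=> lD lZ lM.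
pose J u : R := `|u| ^+ 2 - 2 * l u.
have Jlb : lbound (range J) (- M ^+ 2).
  move=> _ [u _ <-]; rewrite /J.
  have := lM u; rewrite ler_norml => /andP[_ lu].
  have := sqr_ge0 (`|u| - M); rewrite sqrrB; lra.
have hJ : has_inf (range J).
  by split; [exists (J 0); exists 0 | exists (- M ^+ 2)].
set m := inf (range J).
have mJ u : m <= J u by apply: ge_inf; [exact: hJ.2|exists u].
have /choice[s sP] : forall n : nat, exists u, J u < m + n.+1%:R^-1.
  move=> n; have n0 : 0 < n.+1%:R^-1 :> R by rewrite invr_gt0.
  by have [_ [u _ <-] Ju] := inf_adherent n0 hJ; exists u.
have sC i j : `|s i - s j| ^+ 2 <= 2 * i.+1%:R^-1 + 2 * j.+1%:R^-1.
  have := mJ (2^-1 *: (s i + s j)); have := sP i; have := sP j.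
  rewrite /J lZ lD !hip !ipE (ipC (s j)).
  by move: i.+1%:R^-1 j.+1%:R^-1 => a b; lra.
have cs : cvg (s @ \oo).
  apply/cauchy_cvgP/cauchy_exP => e e0.
  have e24 : 0 < e ^+ 2 / 4 by rewrite divr_gt0// exprn_gt0.
  have [N _ NP] := near_infty_natSinv_lt (PosNum e24).
  exists (s N), N => // i /= Ni.
  rewrite -ball_normE /= -(@ltr_pXn2r _ 2)// ?nnegrE ?(ltW e0)//.
  apply: le_lt_trans (sC N i) _.
  have := NP _ Ni; have := NP _ (leqnn N); rewrite /=.
  by move: N.+1%:R^-1 i.+1%:R^-1 => c d; lra.
exists (lim (s @ \oo)) => v; set p := lim _.
(* First-order condition in the direction [v]: [m] is at most [J (s n + a *: v)], while
   [J (s n) < m + 1 / (n + 1)]; then [n] tends to infinity. *)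
have key a : 0 <= 2 * a * (ip p v - l v) + a ^+ 2 * `|v| ^+ 2.
  have gc : (2 * a * (ip (s n) v - l v) + a ^+ 2 * `|v| ^+ 2 + n.+1%:R^-1)
      @[n --> \oo] --> 2 * a * (ip p v - l v) + a ^+ 2 * `|v| ^+ 2 + 0.
    apply: cvgD; last exact: cvg_harmonic.
    apply: cvgD; last exact: cvg_cst.
    by apply: cvgMl_tmp; apply: cvgB; [exact: cvg_ipl|exact: cvg_cst].
  rewrite -[leRHS]addr0; apply: ler_cvg_to (cvg_cst (0 : R)) gc _.
  near=> n; have := mJ (s n + a *: v); have := sP n.
  rewrite /J !(lD, lZ) !hip !ipE (ipC v).
  by move: n.+1%:R^-1 => c; nra.
(* With [c = ip p v - l v] and [q = |v|^2], the choice [a = - c / (q + 1)] turns [key] into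
   [0 <= - a^2 (q + 2)], so [a], and with it [c], vanishes. *)
have := key (- (ip p v - l v) / (`|v| ^+ 2 + 1)).
move Ec : (ip p v - l v) => c; move: (`|v| ^+ 2) (sqr_ge0 `|v|) => q q0.
have : c = - (- c / (q + 1)) * (q + 1) by field; rewrite gt_eqF// ltr_wpDl.
move: (- c / (q + 1)) => b cb key_b; rewrite cb in key_b.
have /eqP : b ^+ 2 = 0 by apply/eqP; rewrite eq_le sqr_ge0 andbT; nra.
rewrite sqrf_eq0 => /eqP b0; apply/esym/eqP.
by rewrite -subr_eq0 Ec cb b0 oppr0 mul0r.
Unshelve. all: by end_near.
Qed.

(** The image ultrafilter contains the compact segment [[- M, M]], so it clusters at some point, and
    an ultrafilter converges to each of its cluster points. *)
Lemma ultra_bounded_cvg {T} (U : set_system T) {FU : UltraFilter U}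
    (f : T -> R) (M : R) :
  (\forall t \near U, `|f t| <= M) -> exists l : R, f @ U --> l.
Proof.
move=> fM.
have fU : (f @ U) [set` `[- M, M]].
  by apply: filterS fM => t /=; rewrite in_itv/= -ler_norml.
have [l [_ lU]] := @segment_compact R (- M) M (f @ U) _ fU.
exists l => N Nl.
have [//|UN] := in_ultra_setVsetC (f @^-1` N) FU.
by have [y [/= nNy Ny]] := lU (~` N) N UN Nl.
Qed.

(** The limits of [ip (x t) v] along [U] are linear in [v] and bounded by [M * |v|], so Riesz
    representation provides the weak limit. *)
Lemma ultra_weak_cvg {T} (U : set_system T) {FU : UltraFilter U}
    (x : T -> H) (M : R) :
  (\forall t \near U, `|x t| <= M) ->
  exists p, forall v, ip (x t) v @[t --> U] --> ip p v.
Proof.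
move=> xM.
have bnd v : \forall t \near U, `|ip (x t) v| <= M * `|v|.
  by apply: filterS xM => t xt; rewrite (le_trans (normr_ip_le _ _))// ler_wpM2r.
have /choice[l lP] : forall v, exists l : R, ip (x t) v @[t --> U] --> l.
  by move=> w; apply: ultra_bounded_cvg; exact: bnd.
have [||u|p pl] := @riesz_representation l M.
- move=> u v; apply: cvg_unique (lP (u + v)) _ => //=.
  by rewrite (eq_cvg _ _ (fun t => ipDr (x t) u v)); exact: cvgD.
- move=> a u; apply: cvg_unique (lP (a *: u)) _ => //=.
  by rewrite (eq_cvg _ _ (fun t => ipZr a (x t) u)); exact: cvgMl_tmp.
- have PU : ProperFilter U by exact: ultra_proper.
  rewrite leNgt; apply/negP => Mlu.
  have cn : `|ip (x t) u| @[t --> U] --> `|l u| by apply: cvg_norm; exact: lP.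
  have [t [Mt]] := filter_ex (filterI (cvgr_gt _ cn _ Mlu) (bnd u)).
  by rewrite leNgt Mt.
by exists p => v; rewrite -pl.
Qed.

End hilbert.

(** * Functions with finitely many values *)

Section finite_image.
Context {d : measure_display} {T : measurableType d} {D : set T}.

(** [S] carries no sigma-algebra: the preimage of [Y] is a finite union of measurable level sets.
    Vector-valued simple functions can thus be handled without a Borel structure on [H]. *)
Lemma measurable_fun_comp_finite {d' : measure_display} {U : measurableType d'}
    {S : Type} (f : T -> S) (phi : S -> U) :
  finite_set (f @` D) -> (forall y, measurable (D `&` f @^-1` [set y])) ->
  measurable_fun D (phi \o f).
Proof.
move=> fD fm _ Y mY.
rewrite (_ : _ `&` _ = \bigcup_(y in f @` D `&` phi @^-1` Y)
    (D `&` f @^-1` [set y])).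
  by apply: fin_bigcup_measurable => //; exact: finite_setIl.
apply/seteqP; split => [t [Dt Yt]|t [y [_ Yy] [Dt /= fty]]].
  by exists (f t) => //; split => //; exists t.
by split => //=; rewrite fty.
Qed.

Lemma finite_image_pair {S S' : Type} (f : T -> S) (g : T -> S') :
  finite_set (f @` D) -> finite_set (g @` D) ->
  finite_set ((fun t => (f t, g t)) @` D).
Proof.
move=> ff fg; apply: sub_finite_set (finite_setX ff fg) => _ [t Dt <-].
by split; exists t.
Qed.

Lemma measurable_level_pair {S S' : Type} (f : T -> S) (g : T -> S') :
  (forall y, measurable (D `&` f @^-1` [set y])) ->
  (forall y, measurable (D `&` g @^-1` [set y])) ->
  forall y, measurable (D `&` (fun t => (f t, g t)) @^-1` [set y]).
Proof.
move=> mf mg [y z]; rewrite (_ : _ `&` _ =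
    (D `&` f @^-1` [set y]) `&` (D `&` g @^-1` [set z])); first exact: measurableI.
by apply/seteqP; split => [t [Dt [<- <-]]|t [[Dt /= <-] [_ /= <-]]].
Qed.

End finite_image.

(* No measurability is needed: the integral of a nonnegative function is a
   supremum over the simple functions below it. *)
Lemma ge0_le_lower_integral {d : measure_display} {T : measurableType d}
    {R : realType} (mu : {measure set T -> \bar R}) (D : set T)
    (f g : T -> \bar R) :
  (forall t, D t -> 0 <= f t)%E -> (forall t, D t -> f t <= g t)%E ->
  (\int[mu]_(t in D) f t <= \int[mu]_(t in D) g t)%E.
Proof.
move=> f0 fg; rewrite !ge0_integralE//; last first.
  by move=> t Dt; rewrite (le_trans (f0 _ Dt))// fg.
apply: ereal_sup_le => _ [h hf <-]; exists h => //= t.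
rewrite (le_trans (hf t))// !patchE; case: ifPn => // /set_mem; exact: fg.
Qed.

(** * Bochner integrals tested against vectors *)

Section bochner_integral.
Context {d : measure_display} {T : measurableType d} {R : realType}.
Context {H : completeNormedModType R} {ip : {dot H for idfun}}.
Hypothesis hip : forall u : H, `|u| ^+ 2 = ip u u.
Context {mu : {measure set T -> \bar R}} {D : set T}.
Hypotheses (mD : measurable D) (D_fin : (mu D < +oo)%E).

Lemma measurable_comp_simple (s : T -> H) (phi : H -> R) :
  simple_on mu D s -> measurable_fun D (phi \o s).
Proof. by case=> fs ms _; exact: measurable_fun_comp_finite. Qed.

Lemma integrable_comp_simple (s : T -> H) (phi : H -> R) :
  simple_on mu D s -> mu.-integrable D (EFin \o (phi \o s)).
Proof.
move=> ss; apply: measurable_bounded_integrable => //.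
  exact: measurable_comp_simple.
case: ss => fs _ _.
have [M MP] : exists M, forall v, (s @` D) v -> `|phi v| <= M.
  exists (\sum_(v \in s @` D) `|phi v|) => v sv.
  by rewrite (fsbigD1 v)//= lerDl fsumr_ge0.
exists M; split; first exact: num_real.
by move=> N MN t Dt /=; rewrite (le_trans _ (ltW MN))// MP//; exists t.
Qed.

(** Decompose [s] into multiples of indicators of its level sets and exchange the finite sum with
    the integral. *)
Lemma ip_simple_integral (s : T -> H) (v : H) : simple_on mu D s ->
  ip (simple_integral mu D s) v = \int[mu]_(t in D) ip (s t) v.
Proof.
move=> [fs ms _]; rewrite /simple_integral fsbig_finite//=.
set E := finmap.enum_fset _.
pose A w := D `&` s @^-1` [set w].
have mA w : measurable (A w) by exact: ms.
have int1 w : mu.-integrable D (EFin \o \1_(A w)).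
  apply: measurable_bounded_integrable => //.
  exists 1; split; first exact: num_real.
  move=> N N1 t Dt /=; rewrite (le_trans _ (ltW N1))//.
  by rewrite indicE; case: (_ \in _); rewrite ?normr1 ?normr0.
have intA w : mu.-integrable D (fun t => (ip w v * \1_(A w) t)%:E).
  have := integrableZl mD (ip w v) (int1 w).
  by apply: eq_integrable => // t _ /=; rewrite EFinM.
transitivity (\sum_(w <- E) (\int[mu]_(t in D) (ip w v * \1_(A w) t))).
  rewrite (big_morph (fun u => ip u v) (fun u w => ipDl ip u w v) (linear0l ip v)).
  apply: eq_bigr => w _; rewrite ipZl RintegralZl// mulrC; congr (_ * _).
  by rewrite /Rintegral integral_indic// setIAC setIid.
transitivity (\int[mu]_(t in D) (\sum_(w <- E) (ip w v * \1_(A w) t))).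
  rewrite /Rintegral; under [in RHS]eq_integral do rewrite -sumEFin.
  rewrite integral_sum// -[LHS]/(fine (_)%:E) -sumEFin; congr fine.
  by apply: eq_bigr => w _; rewrite fineK// integrable_fin_num.
apply: eq_Rintegral => t /set_mem Dt.
rewrite -(@fsbig_finite _ _ _ _ _ (fun w => ip w v * \1_(A w) t))//.
rewrite (fsbigD1 (s t))//=; last by exists t.
rewrite fsbig1 => [|w [_ /= swt]].
  by rewrite addr0 indicE mem_set ?mulr1//; split.
by rewrite indicE memNset ?mulr0// => -[_ /= wst]; exact: swt.
Qed.

(* [f] itself need not be measurable when the measure is not complete, hence its
   replacement by [g], which vanishes on the exceptional null set. *)
Lemma bochner_integral_ip (f : T -> H) (I : H) : is_bochner_integral mu D f I ->
  exists g : T -> H,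
  [/\ {ae mu, forall t, D t -> f t = g t},
      mu.-integrable D (EFin \o (fun t => `|g t|)),
      forall v, mu.-integrable D (EFin \o (fun t => ip (g t) v)) &
      forall v, ip I v = \int[mu]_(t in D) ip (g t) v].
Proof.
move=> [s [ss [N [mN N0 subN]] lim_err limI]].
pose off u t : H := if t \in N then 0 else u t.
pose g := off f; pose s' n := off (s n).
have s'g t : D t -> s' n t @[n --> \oo] --> g t.
  move=> Dt; rewrite /s' /g /off; case: ifPn => [_|/negP tN]; first exact: cvg_cst.
  by apply: contrapT => nst; apply: tN; apply/mem_set/subN => /(_ Dt).
(* [s m], [s n] and membership in [N] are bundled into one function with finitely many values, so
   that every [phi] of the two truncated functions is measurable. *)
have m_pair (phi : H -> H -> R) m n : measurable_fun D (fun t => phi (s' m t) (s' n t)).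
  pose psi (y : (H * H) * bool) := if y.2 then phi 0 0 else phi y.1.1 y.1.2.
  have -> : (fun t => phi (s' m t) (s' n t)) =
      psi \o (fun t => ((s m t, s n t), t \in N)).
    by apply/funext => t; rewrite /psi /s' /off /=; case: ifP.
  have [[fm lm _] [fn ln _]] := (ss m, ss n).
  apply: measurable_fun_comp_finite.
    by do 2?[apply: finite_image_pair => //].
  apply: measurable_level_pair; first exact: measurable_level_pair.
  case.
  - rewrite (_ : _ @^-1` _ = N); first exact: measurableI.
    by apply/seteqP; split=> t /=; [move/set_mem|move/mem_set].
  - rewrite (_ : _ @^-1` _ = ~` N).
      by apply: measurableI => //; exact: measurableC.
    apply/seteqP; split=> t /= tN; last exact: memNset.
    by move/mem_set; rewrite tN.
have m_norm_err n : measurable_fun D (fun t => `|g t - s' n t|).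
  apply: (@measurable_fun_cvg _ _ _ _ (fun m t => `|s' m t - s' n t|)).
    by move=> m; exact: (m_pair (fun u v => `|u - v|)).
  move=> t Dt; apply: cvg_norm; apply: cvgB; [exact: s'g|exact: cvg_cst].
have m_norm : measurable_fun D (fun t => `|g t|).
  apply: (@measurable_fun_cvg _ _ _ _ (fun m t => `|s' m t|)).
    by move=> m; exact: (m_pair (fun u _ => `|u|) m m).
  by move=> t Dt; apply: cvg_norm; exact: s'g.
have m_ip v : measurable_fun D (fun t => ip (g t) v).
  apply: (@measurable_fun_cvg _ _ _ _ (fun m t => ip (s' m t) v)).
    by move=> m; exact: (m_pair (fun u _ => ip u v) m m).
  by move=> t Dt; apply: cvg_ipl => //; exact: s'g.
pose err n := (\int[mu]_(t in D) (`|f t - s n t|)%:E)%E.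
(* [f] may fail to be measurable, so [err n] is a lower integral; it still dominates the integral of
   the measurable function [|g - s' n|]. *)
have err_le n : (\int[mu]_(t in D) (`|g t - s' n t|)%:E <= err n)%E.
  apply: ge0_le_lower_integral => t _; rewrite ?lee_fin//.
  by rewrite /g /s' /off; case: ifP; rewrite // subr0 normr0.
have [err_fin err0] : (\forall n \near \oo, err n \is a fin_num) /\
    fine (err n) @[n --> \oo] --> 0 by apply/fine_cvgP.
have int_err n : err n \is a fin_num ->
    mu.-integrable D (EFin \o (fun t => `|g t - s' n t|)).
  move=> en; apply/integrableP; split; first exact/measurable_EFinP.
  under eq_integral do rewrite /= normr_id.
  by rewrite (le_lt_trans (err_le n))// ltey_eq en.
have int_s' n : mu.-integrable D (EFin \o (fun t => `|s' n t|)).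
  apply: le_integrable (integrable_comp_simple Num.norm (ss n)) => //.
    by apply/measurable_EFinP; exact: (m_pair (fun u _ => `|u|) n n).
  move=> t Dt; rewrite /= !normr_id lee_fin /s' /off.
  by case: ifP; rewrite ?normr0.
(* Fix one [n] with finite error and write [g] as [(g - s' n) + s' n]. *)
have int_g : mu.-integrable D (EFin \o (fun t => `|g t|)).
  have [n en] := filter_ex err_fin.
  apply: le_integrable (integrableD mD (int_err n en) (int_s' n)) => //.
    exact/measurable_EFinP.
  move=> t Dt; rewrite /= lee_fin normr_id ger0_norm ?addr_ge0//.
  by rewrite (le_trans _ (ler_normD _ _))// subrK.
have int_ip (h : T -> H) v : measurable_fun D (fun t => ip (h t) v) ->
    mu.-integrable D (EFin \o (fun t => `|h t|)) ->
    mu.-integrable D (EFin \o (fun t => ip (h t) v)).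
  move=> mh ih; apply: le_integrable (integrableZl mD `|v| ih) => //.
    exact/measurable_EFinP.
  by move=> t Dt; rewrite /= lee_fin normrM !normr_id mulrC normr_ip_le.
exists g; split => // [|v|v].
- exists N; split => // t /= ft; apply: contrapT => tN; apply: ft => _.
  by rewrite /g /off memNset.
- exact: int_ip.
have int_s'_ip n : mu.-integrable D (EFin \o (fun t => ip (s' n t) v)).
  by apply: int_ip => //; exact: (m_pair (fun u _ => ip u v) n n).
have ip_s n : ip (simple_integral mu D (s n)) v = \int[mu]_(t in D) ip (s' n t) v.
  rewrite ip_simple_integral// /Rintegral; congr fine; apply: ae_eq_integral => //.
  - by apply/measurable_EFinP; exact: (measurable_comp_simple (ip^~ v)).
  - by apply/measurable_EFinP; exact: (m_pair (fun u _ => ip u v) n n).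
  - exists N; split => // t /= ft; apply: contrapT => tN; apply: ft => _.
    by rewrite /s' /off memNset.
have lim_ip : ip (simple_integral mu D (s n)) v @[n --> \oo] --> ip I v.
  exact: cvg_ipl.
apply: cvg_unique lim_ip _ => //=.
apply/cvgrPdist_le => e e0.
have e0' : 0 < e / (`|v| + 1) by rewrite divr_gt0// ltr_wpDl.
near=> n.
have en : err n \is a fin_num by near: n.
rewrite ip_s -RintegralB//; last exact: int_ip.
have int_diff : mu.-integrable D (EFin \o (fun t => ip (g t) v - ip (s' n t) v)).
  exact: integrableB (int_ip _ _ (m_ip v) int_g) (int_s'_ip n).
rewrite (le_trans (le_normr_Rintegral _ _))//.
apply: (@le_trans _ _ (`|v| * fine (err n))); last first.
  apply: (@le_trans _ _ (`|v| * (e / (`|v| + 1)))).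
    rewrite ler_wpM2l// (le_trans (ler_norm _))//; near: n.
    by apply: cvgr0_norm_le.
  rewrite mulrCA ler_piMr ?(ltW e0)//.
  by rewrite ler_pdivrMr ?ltr_wpDl// mul1r lerDl.
apply: (@le_trans _ _ (\int[mu]_(t in D) (`|v| * `|g t - s' n t|))).
  apply: le_Rintegral => //.
  - exact: integrable_norm.
  - exact: (integrableZl mD `|v| (int_err n en)).
  - move=> t Dt; rewrite -ipNl -ipDl mulrC; exact: normr_ip_le.
rewrite RintegralZl//; last exact: int_err.
rewrite ler_wpM2l// fine_le ?err_le//.
by apply: integrable_fin_num => //; exact: int_err.
Unshelve. all: by end_near.
Qed.

End bochner_integral.

Lemma ae_le_Rintegral {d : measure_display} {T : measurableType d}
    {R : realType} (mu : {measure set T -> \bar R}) (D : set T) (f1 f2 : T -> R) :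
  measurable D ->
  mu.-integrable D (EFin \o f1) -> mu.-integrable D (EFin \o f2) ->
  {ae mu, forall t, D t -> f1 t <= f2 t} ->
  \int[mu]_(t in D) f1 t <= \int[mu]_(t in D) f2 t.
Proof.
move=> mD if1 if2 [N [mN N0 subN]].
have mDN : measurable (D `\` N) by exact: measurableD.
rewrite /Rintegral (negligible_integral mN mD if1 N0) (negligible_integral mN mD if2 N0).
apply: le_Rintegral => //.
- by apply: integrableS if1.
- by apply: integrableS if2.
- by move=> t [Dt Nt]; apply: contrapT => f12; apply/Nt/subN => /(_ Dt).
Qed.

(** * Increments of absolutely continuous functions *)

Section lebesgue_increments.
Context {R : realType}.
Local Notation mu := (@lebesgue_measure R).

Lemma Rintegral_increment_le (f : R -> R) (s t C : R) : 0 <= s <= t ->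
  mu.-integrable `[0, t] (EFin \o f) ->
  {ae mu, forall r, s <= r <= t -> f r <= C} ->
  \int[mu]_(r in `[0, t]) f r - \int[mu]_(r in `[0, s]) f r <= C * (t - s).
Proof.
move=> /andP[s0 st] intf fC.
rewrite Rintegral_itvB ?bnd_simp//.
have -> : C * (t - s) = \int[mu]_(r in `]s, t]) C.
  rewrite Rintegral_cst//= lebesgue_measure_itv/= lte_fin.
  by move: st; rewrite le_eqVlt => /predU1P[->|->]//=; rewrite ltxx subrr.
have fC' : {ae mu, forall r, `]s, t]%classic r -> f r <= C}.
  apply: (@filterS _ _ (ae_filter_ringOfSetsType mu)) fC => r fC.
  rewrite /= in_itv/= => /andP[/ltW sr rt].
  by apply: fC; rewrite sr.
apply: ae_le_Rintegral => //.
- apply: integrableS intf => // r /=; rewrite !in_itv/= => /andP[sr ->].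
  by rewrite (le_trans s0 (ltW sr)).
- apply: measurable_bounded_integrable => //.
    by rewrite /= lebesgue_measure_itv; case: ifP => _; rewrite ?ltry.
  exists `|C|; split; first exact: num_real.
  by move=> N /ltW CN r _.
Qed.

Section hilbert_valued.
Context {H : completeNormedModType R} {ip : {dot H for idfun}}.
Hypothesis hip : forall u : H, `|u| ^+ 2 = ip u u.
Context {x dx : R -> H}.
Hypothesis x_ac : loc_abs_cont x dx.

(** [loc_abs_cont] supplies a separate Bochner integral for each [t]. The representatives on
    [[0, T]] and on [[0, t]] both agree almost everywhere with [dx], so a single [g] serves all
    [t <= T]. *)
Lemma loc_abs_cont_ip (T : R) : 0 <= T -> exists g : R -> H,
  [/\ {ae mu, forall r, 0 <= r <= T -> dx r = g r},
      mu.-integrable `[0, T] (EFin \o (fun r => `|g r|)),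
      forall v, mu.-integrable `[0, T] (EFin \o (fun r => ip (g r) v)) &
      forall t v, 0 <= t <= T ->
        ip (x t - x 0) v = \int[mu]_(r in `[0, t]) ip (g r) v].
Proof.
move=> T0.
have itv_fin (b : R) : (mu `[0%R, b] < +oo)%E.
  by rewrite /= lebesgue_measure_itv; case: ifP => _; rewrite ?ltry.
have [g [dxg intg ipg _]] := @bochner_integral_ip _ _ _ _ _ hip mu _
  (measurable_itv `[0, T]) (itv_fin T) _ _ (x_ac T0).
exists g; split => // t v /andP[t0 tT].
have [h [dxh _ iph ->]] := @bochner_integral_ip _ _ _ _ _ hip mu _
  (measurable_itv `[0, t]) (itv_fin t) _ _ (x_ac t0).
rewrite /Rintegral; congr fine; apply: ae_eq_integral => //.
- by case/integrableP : (iph v).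
- have := ipg v => /integrableP[+ _]; apply: measurable_funS => //.
  by apply: subset_itvl; rewrite bnd_simp.
- apply: (@filterS2 _ _ (ae_filter_ringOfSetsType mu)) dxg dxh => r gr hr rt.
  rewrite /= -hr// gr//.
  by move: rt; rewrite /= !in_itv/= => /andP[-> /le_trans]; apply.
Qed.

Lemma loc_abs_cont_increment_le (s t C : R) (v : H) : 0 <= s <= t ->
  {ae mu, forall r, s <= r <= t -> ip (dx r) v <= C} ->
  ip (x t - x s) v <= C * (t - s).
Proof.
move=> /andP[s0 st] dxC; have t0 := le_trans s0 st.
have [g [dxg _ ipg xg]] := loc_abs_cont_ip t0.
have -> : x t - x s = (x t - x 0) - (x s - x 0).
  by rewrite opprB addrA subrK.
rewrite ipDl ipNl !xg ?s0 ?t0 ?lexx//.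
apply: Rintegral_increment_le => //; first exact/andP.
apply: (@filterS2 _ _ (ae_filter_ringOfSetsType mu)) dxg dxC => r gr dxr /andP[sr rt].
by rewrite -gr ?dxr// ?sr// (le_trans s0 sr).
Qed.

(** Testing [u = x t - x 0] against itself bounds [|u|^2] by [|u|] times the integral of [|g|]. This
    rough bound comes before any use of the dynamics and lets the energy estimate start. *)
Lemma loc_abs_cont_bounded (T : R) : 0 <= T ->
  exists M, forall t, 0 <= t <= T -> `|x t - x 0| <= M.
Proof.
move=> T0; have [g [_ intg ipg xg]] := loc_abs_cont_ip T0.
exists (\int[mu]_(r in `[0, T]) `|g r|) => t tT.
set M := Rintegral _ _ _; set u := x t - x 0.
have [->|u0] := eqVneq u 0; first by rewrite normr0; apply: Rintegral_ge0.
rewrite -(@ler_pM2r _ `|u|) ?normr_gt0// -expr2 hip {1}/u xg//.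
have sub : `[0, t] `<=` `[0, T].
  by apply: subset_itvl; rewrite bnd_simp; case/andP : tT.
have intgt : mu.-integrable `[0, t] (EFin \o (fun r => `|g r|)).
  exact: integrableS intg.
apply: (@le_trans _ _ (\int[mu]_(r in `[0, t]) (`|u| * `|g r|))).
  apply: le_Rintegral => //.
  - exact: integrableS (ipg u).
  - exact: (integrableZl _ `|u| intgt).
  - by move=> r _; rewrite mulrC; exact: cauchy_schwarz.
rewrite RintegralZl// mulrC ler_wpM2r//.
rewrite fine_le ?integrable_fin_num//.
apply: ge0_subset_integral => //.
by case/integrableP : intg.
Qed.

End hilbert_valued.

Lemma real_loc_abs_cont_lipschitz (f df : R -> R) (L : R) :
  real_loc_abs_cont f df -> {ae mu, forall r, 0 <= r -> `|df r| <= L} ->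
  forall s t, 0 <= s <= t -> `|f t - f s| <= L * (t - s).
Proof.
move=> f_ac dfL s t /andP[s0 st]; have t0 := le_trans s0 st.
have [_ fsE] := f_ac _ s0; have [intf ftE] := f_ac _ t0.
rewrite fsE ftE opprD addrACA subrr add0r Rintegral_itvB ?bnd_simp//.
rewrite (le_trans (le_normr_Rintegral _ _))//.
  apply: integrableS intf => // r /=; rewrite !in_itv/= => /andP[sr ->].
  by rewrite (le_trans s0 (ltW sr)).
rewrite -(@Rintegral_itvB _ _ (BLeft 0)) ?bnd_simp//; last exact: integrable_norm.
apply: Rintegral_increment_le; first exact/andP; first exact: integrable_norm.
apply: (@filterS _ _ (ae_filter_ringOfSetsType mu)) dfL => r dfr /andP[sr _].
exact: dfr (le_trans s0 sr).
Qed.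

Lemma Lfun_oo_ae_bounded (f : R -> R) : f \_ `[0, +oo[ \in Lfun mu +oo%E ->
  exists L, {ae mu, forall r, 0 <= r -> `|f r| <= L}.
Proof.
(* The norm of order [+oo] is an essential supremum only when the whole space has positive measure,
   which is checked here for the real line. *)
move=> /andP[_]; rewrite inE /= /finite_norm unlock ifT; last first.
  have := @lebesgue_measure_itv R `]-oo, +oo[.
  by rewrite set_itvNyy /= => muT; apply: (lt_le_trans (ltry 0)); rewrite muT.
move=> /(@ess_supr_bounded _ _ _ mu (fun r => `|(f \_ `[0, +oo[) r|))[L LP].
exists L; apply: (@filterS _ _ (ae_filter_ringOfSetsType mu)) LP => r + r0.
by rewrite patchE mem_set//= in_itv/= r0.
Qed.

End lebesgue_increments.

(** * Estimates for one step of forward-backward-forward splitting *)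

Section forward_backward_forward_step.
Context {R : realType} {H : completeNormedModType R} {ip : {dot H for idfun}}.
Hypothesis hip : forall u : H, `|u| ^+ 2 = ip u u.
Context {A : H -> set H} {B : H -> H} {beta : R}.
Hypotheses (monA : monotone_op ip A) (monB : monotone_op ip (op_of B)).
Hypotheses (beta0 : 0 < beta) (lipB : (beta^-1).-lipschitz B).

Lemma lipschitz_norm_le (u v : H) : `|B u - B v| <= beta^-1 * `|u - v|.
Proof. exact: (@lipB (u, v)). Qed.

Lemma resolventP (g : R) (x z : H) : resolvent g A (x - g *: B x) z ->
  exists2 a, A z a & g *: a = x - g *: B x - z.
Proof.
move=> [_ ->] [_ [a Aza <-]] eq_x.
by exists a => //; rewrite -eq_x addrAC subrr add0r.
Qed.

Lemma Zer_addP (p : H) : Zer (op_add A (op_of B)) p <-> A p (- B p).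
Proof.
split=> [[b Apb [_ -> /eqP]]|ApB].
  by rewrite addr_eq0 => /eqP <-.
by exists (- B p) => //; exists (B p) => //; rewrite addNr.
Qed.

(** With [u], [v], [w], [b] as in the proof, [g (a - a') = v - u - g b - ((g - g') / g') w].
    Monotonicity of [A] makes its product with [u] nonnegative, which bounds [|u|^2]. The terms in
    [v] and [b] each contribute at most [|u| |v|], since [g <= beta]; finally divide by [|u|]. *)
Lemma step_lipschitz (g g' : R) (x x' z z' a a' : H) :
  0 < g <= beta -> 0 < g' ->
  A z a -> A z' a' ->
  g *: a = x - g *: B x - z -> g' *: a' = x' - g' *: B x' - z' ->
  `|z - z'| <= 2 * `|x - x'| + `|g - g'| * (`|x' - z'| / g').
Proof.
move=> /andP[g0 gb] g'0 Aza Aza' ga ga'.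
have a'E : a' + B x' = g'^-1 *: (x' - z').
  have -> : x' - z' = g' *: (a' + B x') by rewrite scalerDr ga' addrAC subrK.
  by rewrite scalerA mulVf ?scale1r ?gt_eqF.
have [zz'|zz'] := eqVneq z z'.
  by rewrite zz' subrr normr0 addr_ge0 ?mulr_ge0 ?invr_ge0 ?(ltW g'0).
have := mulr_ge0 (ltW g0) (monA Aza Aza'); move: a'E.
set u := z - z'; set v := x - x'; set w := x' - z'; set b := B x - B x'.
have u0 : 0 < `|u| by rewrite normr_gt0 subr_eq0.
have hv := cauchy_schwarz hip u v.
have hb : g * - ip u b <= `|u| * `|v|.
  rewrite -ipNr (le_trans (ler_wpM2l (ltW g0) (cauchy_schwarz hip _ _)))//.
  rewrite normrN mulrCA ler_wpM2l// (le_trans (ler_wpM2l (ltW g0) (lipschitz_norm_le _ _)))//.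
  by rewrite mulrA ler_piMl// ler_pdivrMr// mul1r.
have hw : - ((g - g') * (g'^-1 * ip u w)) <= `|u| * (`|g - g'| * (`|w| / g')).
  rewrite -mulNr (le_trans (ler_norm _))// !normrM normrN normfV (gtr0_norm g'0).
  rewrite [leRHS]mulrCA ler_wpM2l// mulrA mulrC ler_wpM2r ?invr_ge0 ?(ltW g'0)//.
  exact: normr_ip_le.
have ka : g * ip u a = ip u (x - g *: B x - z) by rewrite -ga ipZr.
have ka' : g' * ip u a' = ip u (x' - g' *: B x' - z') by rewrite -ga' ipZr.
have uu : `|u| * `|u| = ip u z - ip u z' by rewrite -expr2 hip -ipNr -ipDr.
move=> /(congr1 (fun y => (g - g') * ip u y)); rewrite ipDr ipZr => kw h.
rewrite -(ler_pM2l u0); move: hv hb hw ka ka' kw h uu.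
rewrite /v /b !(ipDr, ipNr, ipZr); lra.
Qed.

(** A zero [p] is a fixed point of the step, so it serves as the second input and the second output
    at once. *)
Lemma step_bound (g : R) (x z a p : H) : 0 < g <= beta ->
  A z a -> g *: a = x - g *: B x - z -> A p (- B p) ->
  `|z - p| <= 2 * `|x - p|.
Proof.
move=> gb Aza ga Ap; have g0 : 0 < g by case/andP: gb.
have gp : g *: - B p = p - g *: B p - p by rewrite addrAC subrr add0r scalerN.
have := step_lipschitz gb g0 Aza Ap ga gp.
by rewrite (subrr g) normr0 mul0r addr0.
Qed.

(** Let [d = z - x + g (B x - B z)]. Adding the monotonicity of [A] and of [B] between [z] and [p]
    gives [ip d (z - p) <= 0], and [ip d (x - z)] is estimated by the Lipschitz bound on [B]. *)
Lemma step_dissipation (g : R) (x z a p : H) : 0 < g ->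
  A z a -> g *: a = x - g *: B x - z -> A p (- B p) ->
  ip (z - x + g *: (B x - B z)) (x - p) <= - (1 - g / beta) * `|x - z| ^+ 2.
Proof.
move=> g0 Aza ga Ap.
have h1 := mulr_ge0 (ltW g0) (monA Aza Ap).
have h2 := mulr_ge0 (ltW g0) (@monB z p _ _ erefl erefl).
have h3 : g * ip (x - z) (B x - B z) <= g * (beta^-1 * `|x - z| ^+ 2).
  rewrite ler_pM2l// (le_trans (cauchy_schwarz hip _ _))//.
  by rewrite expr2 mulrCA ler_wpM2l// lipschitz_norm_le.
have kz : g * ip z a = ip z (x - g *: B x - z) by rewrite -ga ipZr.
have kp : g * ip p a = ip p (x - g *: B x - z) by rewrite -ga ipZr.
rewrite ipC; move: h1 h2 h3 kz kp; rewrite !hip !ipE.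
rewrite (ipC ip p x) (ipC ip p z) (ipC ip z x).
nra.
Qed.

Lemma step_velocity_le (g : R) (x z : H) : 0 < g <= beta ->
  `|z - x + g *: (B x - B z)| <= 2 * `|x - z|.
Proof.
move=> /andP[g0 gb]; rewrite (le_trans (ler_normD _ _))// distrC normrZ gtr0_norm//.
rewrite mulr_natl mulr2n lerD2l.
rewrite (le_trans (ler_wpM2l (ltW g0) (lipschitz_norm_le _ _)))//.
by rewrite mulrA ler_piMl// ler_pdivrMr// mul1r.
Qed.

End forward_backward_forward_step.

(** Over [n + 1] equal pieces of an interval of length [h] the quadratic errors add up to
    [D h^2 / (n + 1)], which tends to 0. *)
Lemma increment_le_subdivision {R : realType} (f : R -> R) (s t C D : R) :
  s <= t -> 0 <= D ->
  (forall u v, s <= u -> u <= v -> v <= t -> f v - f u <= (C + D * (v - u)) * (v - u)) ->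
  f t - f s <= C * (t - s).
Proof.
move=> st D0 fuv; set h := t - s.
have h0 : 0 <= h by rewrite subr_ge0.
have nd (n : nat) : n.+1%:R * (h / n.+1%:R) = h by rewrite mulrCA divff// mulr1.
have step (n k : nat) (d := h / n.+1%:R) : (k <= n.+1)%N ->
    f (s + k%:R * d) - f s <= k%:R * ((C + D * d) * d).
  have d0 : 0 <= d by rewrite divr_ge0.
  elim: k => [_|k IH kn]; first by rewrite !mul0r addr0 subrr.
  have dE : (s + k.+1%:R * d) - (s + k%:R * d) = d.
    by rewrite opprD addrACA subrr add0r -mulrBl -natrB// subSnn mul1r.
  have := fuv (s + k%:R * d) (s + k.+1%:R * d); rewrite dE => fk.
  have {}fk : f (s + k.+1%:R * d) - f (s + k%:R * d) <= (C + D * d) * d.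
    apply: fk.
    - by rewrite lerDl mulr_ge0.
    - by rewrite lerD2l ler_wpM2r// ler_nat.
    - by rewrite -lerBrDl -/h -[leRHS](nd n) ler_wpM2r// ler_nat.
  rewrite -[in leRHS]addn1 natrD mulrDl mul1r.
  have := IH (ltnW kn); lra.
apply/ler_addgt0Pr => e e0.
have Dh1 : 0 < D * h ^+ 2 + 1 by rewrite ltr_wpDl// mulr_ge0// sqr_ge0.
have [n _ /(_ n (leqnn n)) /= nP] := near_infty_natSinv_lt (PosNum (divr_gt0 e0 Dh1)).
have := step n n.+1 (leqnn _); rewrite nd subrKC mulrCA nd => fts.
rewrite (le_trans fts)// mulrDl lerD2l.
rewrite ltr_pdivlMr// in nP.
have : 0 <= n.+1%:R^-1 :> R by [].
by move: (n.+1%:R^-1) nP => i nP i0; lra.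
Qed.

Lemma nonincreasing_ge0_cvg {R : realType} (f : R -> R) :
  (forall s t, 0 <= s <= t -> f t <= f s) -> (forall t, 0 <= t -> 0 <= f t) ->
  exists l, f t @[t --> +oo] --> l /\ forall t, 0 <= t -> l <= f t.
Proof.
move=> fni f0; pose S := [set f t | t in `[0, +oo[].
have Sl t : 0 <= t -> S (f t) by move=> t0; exists t => //=; rewrite in_itv/= t0.
have Sinf : has_inf S.
  split; first by exists (f 0); exact: Sl.
  by exists 0 => _ [t t0 <-]; apply: f0; rewrite /= in_itv/= andbT in t0.
have lef t : 0 <= t -> inf S <= f t.
  by move=> t0; apply: ge_inf; [exact: Sinf.2|exact: Sl].
exists (inf S); split => //; apply/cvgrPdist_le => e e0.
have [y [s s0 fsy] fse] := inf_adherent e0 Sinf.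
rewrite /= in_itv/= andbT in s0; rewrite -fsy in fse.
exists s; split; first exact: num_real.
move=> t st; have t0 := le_trans s0 (ltW st).
rewrite /= distrC ger0_norm ?subr_ge0 ?lef// lerBlDl (le_trans _ (ltW fse))//.
by apply: fni; rewrite s0 ltW.
Qed.

(** * Energy estimates along the trajectory *)

Section trajectory.
Context {R : realType} {H : completeNormedModType R} {ip : {dot H for idfun}}.
Hypothesis hip : forall u : H, `|u| ^+ 2 = ip u u.
Context {A : H -> set H} {B : H -> H} {beta : R}.
Hypotheses (monA : monotone_op ip A) (monB : monotone_op ip (op_of B)).
Hypotheses (beta0 : 0 < beta) (lipB : (beta^-1).-lipschitz B).
Context {gamma : R -> R} {delta epsilon L : R}.
Hypotheses (delta0 : 0 < delta) (epsilon0 : 0 < epsilon).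
Hypothesis gamma_bound : forall t, 0 <= t -> delta <= gamma t <= beta - epsilon.
Hypothesis gamma_lip :
  forall s t, 0 <= s <= t -> `|gamma t - gamma s| <= L * (t - s).
Context {x dx z : R -> H}.
Hypothesis x_ac : loc_abs_cont x dx.
Hypothesis z_res : forall t, 0 <= t ->
  resolvent (gamma t) A (x t - gamma t *: B (x t)) (z t).
Hypothesis dxE : {ae (@lebesgue_measure R), forall t, 0 <= t ->
  dx t = z t - x t + gamma t *: (B (x t) - B (z t))}.
Context {p : H}.
Hypothesis Ap : A p (- B p).

Lemma gamma_range t : 0 <= t -> 0 < gamma t <= beta.
Proof.
move=> /gamma_bound /andP[dg gb]; rewrite (lt_le_trans delta0 dg)/=.
by rewrite (le_trans gb)// lerBlDr lerDl ltW.
Qed.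

Lemma trajectory_z_le t : 0 <= t -> `|z t - p| <= 2 * `|x t - p|.
Proof.
move=> t0; have [a Aza ga] := resolventP (z_res t0).
exact: (step_bound hip monA beta0 lipB (gamma_range t0) Aza ga Ap).
Qed.

Lemma gap_le t : 0 <= t -> `|x t - z t| <= 3 * `|x t - p|.
Proof.
move=> t0; have -> : x t - z t = (x t - p) - (z t - p) by rewrite opprB addrA subrK.
rewrite (le_trans (ler_normB _ _))//; have := trajectory_z_le t0; lra.
Qed.

Lemma velocity_le t : 0 <= t ->
  `|z t - x t + gamma t *: (B (x t) - B (z t))| <= 6 * `|x t - p|.
Proof.
move=> t0; have := step_velocity_le beta0 lipB (x t) (z t) (gamma_range t0).
have := gap_le t0; lra.
Qed.

(** The increment is tested against itself. The bound [M] is local because global boundedness is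
    only deduced later, from [distance_nonincreasing]. *)
Lemma trajectory_increment_le s t M : 0 <= s <= t ->
  (forall r, s <= r <= t -> `|x r - p| <= M) -> `|x t - x s| <= 6 * M * (t - s).
Proof.
move=> st xM; set u := x t - x s.
have [->|u0] := eqVneq u 0.
  rewrite normr0 !mulr_ge0 ?subr_ge0; case/andP: st => // s0 st.
  by apply: le_trans (xM s _) => //; rewrite lexx.
rewrite -(@ler_pM2r _ `|u|) ?normr_gt0// -expr2 hip mulrAC.
apply: (loc_abs_cont_increment_le hip x_ac) => //.
apply: (@filterS _ _ (ae_filter_ringOfSetsType lebesgue_measure)) dxE => r dxr srt.
have r0 : 0 <= r by case/andP: st srt => s0 _ /andP[/(le_trans s0)].
rewrite dxr// (le_trans (cauchy_schwarz hip _ _))// ler_wpM2r//.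
by rewrite (le_trans (velocity_le r0))// ler_wpM2l// xM.
Qed.

Lemma energy_decrease s t M K : 0 <= s <= t ->
  (forall r, s <= r <= t -> `|x r - p| <= M) ->
  (forall r, s <= r <= t -> K <= epsilon / beta * `|x r - z r| ^+ 2) ->
  `|x t - p| ^+ 2 - `|x s - p| ^+ 2 <= - (2 * K) * (t - s).
Proof.
move=> /andP[s0 st] xM wK.
have M0 : 0 <= M by apply: le_trans (xM s _) => //; rewrite lexx.
(* The constant 36 is the product of two factors 6: one from the velocity, one from the displacement
   of [x]. *)
apply: (@increment_le_subdivision _ (fun r => `|x r - p| ^+ 2) _ _ _ (36 * M ^+ 2)) => //.
  by rewrite mulr_ge0// sqr_ge0.
move=> u v su uv vt.
have u0 := le_trans s0 su.
have -> : `|x v - p| ^+ 2 - `|x u - p| ^+ 2 = ip (x v - x u) (x v + x u - p - p).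
  rewrite !hip !ipE (ipC ip p (x v)) (ipC ip p (x u)) (ipC ip (x u) (x v)); ring.
apply: (loc_abs_cont_increment_le hip x_ac); first by rewrite u0.
apply: (@filterS _ _ (ae_filter_ringOfSetsType lebesgue_measure)) dxE => r dxr /andP[ur rv].
have r0 := le_trans u0 ur; rewrite dxr//.
have srt : s <= r <= t by rewrite (le_trans su ur) (le_trans rv vt).
set g := z r - x r + _.
have -> : ip g (x v + x u - p - p) =
    2 * ip g (x r - p) + ip g (x v - x r - (x r - x u)) by rewrite !ipE; ring.
have [a Aza ga] := resolventP (z_res r0).
have [gr0 _] := andP (gamma_range r0).
have diss := step_dissipation hip monA monB lipB gr0 Aza ga Ap.
have wr := wK _ srt.
have gle : `|g| <= 6 * M by rewrite (le_trans (velocity_le r0))// ler_wpM2l// xM.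
have inc : `|x v - x r - (x r - x u)| <= 6 * M * (v - u).
  have xvr : `|x v - x r| <= 6 * M * (v - r).
    apply: trajectory_increment_le; first by rewrite r0.
    by move=> q /andP[rq qv]; rewrite xM// (le_trans _ rq) ?(le_trans qv)//; case/andP: srt.
  have xru : `|x r - x u| <= 6 * M * (r - u).
    apply: trajectory_increment_le; first by rewrite u0.
    by move=> q /andP[uq qr]; rewrite xM// (le_trans su uq) (le_trans qr)//; case/andP: srt.
  rewrite (le_trans (ler_normB _ _))//; lra.
have rest : ip g (x v - x r - (x r - x u)) <= 36 * M ^+ 2 * (v - u).
  rewrite (le_trans (cauchy_schwarz hip _ _))//.
  rewrite (le_trans (ler_pM _ _ gle inc))//.
  by rewrite (_ : 36 * M ^+ 2 * (v - u) = 6 * M * (6 * M * (v - u)))//; ring.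
(* Since [gamma r <= beta - epsilon], the factor [1 - gamma r / beta] is at least
   [epsilon / beta]. *)
have coef : - (1 - gamma r / beta) * `|x r - z r| ^+ 2 <= - K.
  rewrite mulNr lerN2 (le_trans wr)// ler_wpM2r ?sqr_ge0//.
  rewrite -[1](divff (lt0r_neq0 beta0)) -mulrBl ler_pM2r ?invr_gt0//.
  by have /andP[_] := gamma_bound r0; lra.
rewrite -/g in diss; lra.
Qed.

Lemma distance_nonincreasing s t : 0 <= s <= t -> `|x t - p| <= `|x s - p|.
Proof.
move=> /andP[s0 st]; have t0 := le_trans s0 st.
have [M0 M0P] := loc_abs_cont_bounded hip x_ac t0.
rewrite -(@ler_pXn2r _ 2)// ?nnegrE// -subr_le0.
(* Energy estimate with [K = 0]. *)
have -> : 0 = - (2 * 0) * (t - s) by ring.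
apply: (@energy_decrease _ _ (M0 + `|x 0 - p|)); first by rewrite s0.
- move=> r /andP[sr rt]; have -> : x r - p = (x r - x 0) + (x 0 - p) by rewrite addrA subrK.
  by rewrite (le_trans (ler_normD _ _))// lerD2r M0P// (le_trans s0 sr).
- by move=> r _; rewrite mulr_ge0 ?sqr_ge0// divr_ge0// ltW.
Qed.

Lemma distance_cvg : exists l : R, `|x t - p| ^+ 2 @[t --> +oo] --> l /\
  forall t, 0 <= t -> l <= `|x t - p| ^+ 2.
Proof.
apply: nonincreasing_ge0_cvg => [s t st|t _]; last exact: sqr_ge0.
by rewrite lerXn2r ?nnegrE// distance_nonincreasing.
Qed.

(** A gap of size [e] at a late time [t] would stay above [e / 2] on [[t, t + tau]], so the squared
    distance to [p] would lose [2 K tau] there and fall below its limit [l]. *)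
Lemma gap_cvg0 : `|x t - z t| @[t --> +oo] --> (0 : R).
Proof.
pose M := `|x 0 - p|.
have xM r : 0 <= r -> `|x r - p| <= M.
  by move=> r0; rewrite distance_nonincreasing// lexx.
(* The gap decreases at rate at most [La]: [18 M] is three times the speed bound [6 M], once for [x]
   and twice for [z], and the other term comes from the variation of [gamma]. *)
pose La := 18 * M + L * (3 * M / delta).
have gap_lip s t : 0 <= s <= t -> `|x s - z s| - La * (t - s) <= `|x t - z t|.
  move=> st; have /andP[s0 st'] := st; have t0 := le_trans s0 st'.
  have [a Aza ga] := resolventP (z_res t0).
  have [b Azb gb] := resolventP (z_res s0).
  have /andP[gs0 _] := gamma_range s0.
  have := step_lipschitz hip monA beta0 lipB (gamma_range t0) gs0 Aza Azb ga gb.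
  have xts : `|x t - x s| <= 6 * M * (t - s).
    by apply: trajectory_increment_le => // r /andP[sr _]; exact: xM (le_trans s0 sr).
  have ws : `|x s - z s| / gamma s <= 3 * M / delta.
    rewrite ler_pM ?invr_ge0 ?(ltW gs0)//.
      by rewrite (le_trans (gap_le s0))// ler_wpM2l// xM.
    by rewrite lef_pV2 ?posrE//; case/andP: (gamma_bound s0).
  have gws : `|gamma t - gamma s| * (`|x s - z s| / gamma s) <=
      L * (t - s) * (3 * M / delta).
    by rewrite ler_pM// ?gamma_lip// divr_ge0// ltW.
  have tri : `|x s - z s| <= `|x t - x s| + `|x t - z t| + `|z t - z s|.
    have -> : x s - z s = - (x t - x s) + (x t - z t) + (z t - z s).
      by rewrite opprB (addrA (x s - x t)) subrK addrA subrK.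
    rewrite (le_trans (ler_normD _ _))// lerD2r.
    by rewrite (le_trans (ler_normD _ _))// normrN.
  rewrite /La; lra.
have [l [El lE]] := distance_cvg.
apply/cvgr0Pnorm_lt => e e0.
(* Chosen so that [La * tau <= e / 2]; the absolute value is taken because the sign of [La] is
   unknown. *)
pose tau := e / (2 * (`|La| + 1)).
pose K := epsilon / beta * (e / 2) ^+ 2.
have tau0 : 0 < tau by rewrite divr_gt0// mulr_gt0// ltr_wpDl.
have K0 : 0 < K by rewrite mulr_gt0 ?exprn_gt0// divr_gt0.
have lK : l < l + 2 * K * tau by rewrite ltrDl mulr_gt0// mulr_gt0.
near=> t.
have t0 : 0 <= t by near: t; apply: nbhs_pinfty_ge; exact: num_real.
have Et : `|x t - p| ^+ 2 < l + 2 * K * tau.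
  by near: t; apply: (cvgr_lt _ El).
rewrite normr_id ltNge; apply/negP => wt.
have tt : t <= t + tau by rewrite lerDl ltW.
have : `|x (t + tau) - p| ^+ 2 - `|x t - p| ^+ 2 <= - (2 * K) * (t + tau - t).
  apply: (@energy_decrease _ _ M); first by rewrite t0.
    by move=> r /andP[tr _]; rewrite xM// (le_trans t0 tr).
  move=> r /andP[tr rt]; rewrite ler_pM2l ?divr_gt0// lerXn2r ?nnegrE ?divr_ge0 ?(ltW e0)//.
  have /(gap_lip t r) : 0 <= t <= r by rewrite t0.
  have : La * (r - t) <= e / 2.
    apply: (@le_trans _ _ (`|La| * tau)).
      by rewrite (le_trans (ler_wpM2r _ (ler_norm _))) ?subr_ge0// ler_wpM2l// lerBlDl.
    rewrite /tau mulrA ler_pdivrMr ?mulr_gt0 ?ltr_wpDl//.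
    by move: e0; lra.
  lra.
have := lE _ (le_trans t0 tt); lra.
Unshelve. all: by end_near.
Qed.

End trajectory.

(** If the preimage of a neighbourhood [N] were not in [F], its complement could be added to [F],
    and an ultrafilter refining the result would contain both the preimage and its complement. *)
Lemma cvg_ultra {T : Type} {V : topologicalType} (F : set_system T)
    {FF : Filter F} (f : T -> V) (l : V) :
  (forall U : set_system T, UltraFilter U -> F `<=` U -> f @ U --> l) ->
  f @ F --> l.
Proof.
move=> ultra_l N Nl; apply: contrapT => nFN.
pose S := f @^-1` N.
have pG : ProperFilter (within (~` S) F).
  split; last exact: within_filter.
  rewrite /within /= => FS; apply: nFN.
  by apply: (filterS _ FS) => t St; apply: contrapT => /St.
have [U [UU GU]] := ultraFilterLemma pG.
have FU : F `<=` U by move=> P FP; apply: GU; rewrite /within /=; apply: filterS FP.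
have US : U (~` S) by apply: GU; exact: withinT.
have UN : U S := ultra_l U UU FU N Nl.
have [t [St nSt]] := filter_ex (filterI UN US).
exact: nSt.
Qed.

(** * Weak limits along ultrafilters are zeros of the sum *)

Section weak_cluster.
Context {R : realType} {H : completeNormedModType R} {ip : {dot H for idfun}}.
Hypothesis hip : forall u : H, `|u| ^+ 2 = ip u u.
Context {A : H -> set H} {B : H -> H} {beta : R}.
Hypotheses (maxA : maximally_monotone_op ip A) (monB : monotone_op ip (op_of B)).
Hypotheses (beta0 : 0 < beta) (lipB : (beta^-1).-lipschitz B).

Lemma ultra_lim_ge0 {T : Type} (U : set_system T) {UU : UltraFilter U}
    (f : T -> R) (l : R) :
  f @ U --> l -> (\forall t \near U, 0 <= f t) -> 0 <= l.
Proof.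
move=> fl f0; rewrite leNgt; apply/negP => l0.
have [t [ft0]] := filter_ex (filterI (cvgr_lt _ fl _ l0) f0).
by rewrite leNgt ft0.
Qed.

(* Minty's trick with the single test point [p - (beta / 2) (B p - b)]. *)
Lemma lipschitz_monotone_maximal (p b : H) :
  (forall y, 0 <= ip (p - y) (b - B y)) -> b = B p.
Proof.
move=> pb; pose h := B p - b; pose y := p - (beta / 2) *: h.
(* The factor [beta / 2] is half the inverse of the Lipschitz constant, which leads to
   [|h|^2 <= |h|^2 / 2]. *)
have hyB : `|B p - B y| <= `|h| / 2.
  rewrite (le_trans (lipschitz_norm_le lipB _ _))// /y opprB addrCA subrr addr0.
  rewrite normrZ gtr0_norm ?divr_gt0// !mulrA mulVf ?gt_eqF// mul1r.
  by rewrite mulrC.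
have := pb y; rewrite {1}/y opprB addrCA subrr addr0 ipZl pmulr_rge0 ?divr_gt0//.
have -> : b - B y = (B p - B y) - h by rewrite /h opprB [RHS]addrC addrA subrK.
rewrite ipDr ipNr -hip subr_ge0 => h2.
have := le_trans h2 (le_trans (cauchy_schwarz hip _ _) (ler_wpM2l (normr_ge0 h) hyB)).
rewrite mulrA -expr2 => hh.
have : `|h| ^+ 2 <= 0 by lra.
by rewrite real_exprn_even_le0//= normr_eq0 subr_eq0 => /eqP.
Qed.

(* Let [p], [b], [q] be the limits of [x], [B x] (weakly) and [<x, B x>].
   Monotonicity of [B] at [p] gives [<b, p> <= q], whence the limit of the
   monotonicity of [A] makes [(p, - b)] monotonically related to the graph of
   [A].  So [- b] is in [A p], which forces [<b, p> = q], and then the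
   monotonicity of [B] passes to the limit. *)
Lemma ultra_weak_limit_zero {T : Type} (U : set_system T) {UU : UltraFilter U}
    (g : T -> R) (x z : T -> H) (delta M : R) :
  0 < delta ->
  (\forall t \near U, delta <= g t) -> (\forall t \near U, `|x t| <= M) ->
  (\forall t \near U, resolvent (g t) A (x t - g t *: B (x t)) (z t)) ->
  `|x t - z t| @[t --> U] --> (0 : R) ->
  exists2 p, A p (- B p) & forall v, ip (x t) v @[t --> U] --> ip p v.
Proof.
move=> delta0 g_ge x_le z_res gap0.
have [p xp] := ultra_weak_cvg hip x_le.
pose M' := `|B 0| + beta^-1 * M.
have Bx_le : \forall t \near U, `|B (x t)| <= M'.
  apply: filterS x_le => t xM; rewrite -[B (x t)](subrK (B 0)).
  rewrite (le_trans (ler_normD _ _))// addrC lerD2l.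
  rewrite (le_trans (lipschitz_norm_le lipB _ _))// subr0 ler_wpM2l//.
  by rewrite invr_ge0 ltW.
have [b Bxb] := ultra_weak_cvg hip Bx_le.
have [q xBq] : exists q : R, ip (x t) (B (x t)) @[t --> U] --> q.
  apply: (@ultra_bounded_cvg _ _ _ _ _ (M * M')).
  apply: filterS2 x_le Bx_le => t xM BM.
  by rewrite (le_trans (normr_ip_le hip _ _))// ler_pM.
have hB y : 0 <= q - ip p (B y) - ip b y + ip y (B y).
  apply: (@ultra_lim_ge0 _ U _ (fun t => ip (x t) (B (x t)) - ip (x t) (B y) -
      ip (B (x t)) y + ip y (B y))).
    by apply: cvgD; [apply: cvgB => //; exact: cvgB|exact: cvg_cst].
  apply: nearW => t; have := @monB (x t) y _ _ erefl erefl.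
  rewrite !ipE (ipC ip y (B (x t))); lra.
have hA y a : A y a -> 0 <= - q + ip b y - ip p a + ip y a.
  (* [C] collects the costs of replacing [z t] by [x t] in the monotonicity of [A] at [y];
     [M + 1 + |y|] bounds [|z t - y|] once the gap is at most 1. *)
  move=> Aya; pose C := (M + 1 + `|y|) / delta + M' + `|a|.
  have lim : - ip (x t) (B (x t)) + ip (B (x t)) y - ip (x t) a + ip y a +
      C * `|x t - z t| @[t --> U] --> - q + ip b y - ip p a + ip y a + C * 0.
    apply: cvgD; last exact: cvgMl_tmp.
    apply: cvgD; last exact: cvg_cst.
    by apply: cvgB => //; apply: cvgD => //; exact: cvgN.
  rewrite -[leRHS]addr0 -[X in _ + X](mulr0 C); apply: ultra_lim_ge0 lim _.
  have gap1 : \forall t \near U, `|x t - z t| <= 1.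
    by have /cvgr0Pnorm_le := gap0 => /(_ 1 ltr01); apply: filterS => t; rewrite normr_id.
  apply: filterS (filterI (filterI g_ge gap1) (filterI (filterI x_le Bx_le) z_res)).
  move=> t [[gd w1] [[xM BM] /resolventP[c Azc gc]]].
  have g0 := lt_le_trans delta0 gd.
  set w := x t - z t.
  have mono := maxA.1 _ _ _ _ Azc Aya.
  have zc : ip (z t - y) c = ip (z t - y) w / g t - ip (z t - y) (B (x t)).
    have gc' : g t * ip (z t - y) c = ip (z t - y) (x t - g t *: B (x t) - z t).
      by rewrite -gc ipZr.
    apply: (@mulfI _ (g t)); first by rewrite gt_eqF.
    by rewrite gc' /w !(ipDr, ipNr, ipZr); field; rewrite gt_eqF.
  have e1 : ip (z t - y) w / g t <= (M + 1 + `|y|) / delta * `|w|.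
    have zy : `|z t - y| <= M + 1 + `|y|.
      rewrite (le_trans (ler_normB _ _))// lerD2r.
      have -> : z t = x t - w by rewrite /w opprB addrC subrK.
      by rewrite (le_trans (ler_normB _ _))// lerD.
    rewrite mulrAC (@le_trans _ _ (`|z t - y| * `|w| / g t))//.
      by rewrite ler_wpM2r ?invr_ge0 ?(ltW g0)// cauchy_schwarz.
    by rewrite ler_pM ?mulr_ge0 ?invr_ge0 ?(ltW g0) ?ler_wpM2r ?lef_pV2 ?posrE.
  have e2 : ip w (B (x t)) <= M' * `|w|.
    by rewrite mulrC (le_trans (cauchy_schwarz hip _ _))// ler_wpM2l.
  have e3 : ip w a <= `|a| * `|w| by rewrite mulrC; exact: cauchy_schwarz.
  move: mono e1 e2 e3; rewrite ipDr ipNr zc /C.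
  rewrite /w !ipE (ipC ip (B (x t)) y); lra.
have qbp : ip b p <= q by have := hB p; rewrite (ipC ip b p); lra.
have Apb : A p (- b).
  (* The graph of [A] enlarged by the single pair [(p, - b)]. *)
  pose N u := A u `|` [set w | u = p /\ w = - b].
  apply: (maxA.2 N); last by right.
  - move=> y y' c c' [Ac|[-> ->]] [Ac'|[-> ->]].
    + exact: maxA.1.
    + by have := hA _ _ Ac; rewrite !ipE (ipC ip b y) (ipC ip p b); lra.
    + by have := hA _ _ Ac'; rewrite !ipE (ipC ip b y') (ipC ip p b); lra.
    + by rewrite !subrr linear0l.
  - by move=> u w Auw; left.
exists p => //; rewrite -(@lipschitz_monotone_maximal p b)// => y.
have := hA _ _ Apb; have := hB y.
rewrite !ipE (ipC ip b p) (ipC ip y b) (ipC ip b y); lra.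
Qed.

End weak_cluster.

(** * Uniqueness of the weak limit *)

Section uniqueness.
Context {R : realType} {H : completeNormedModType R} {ip : {dot H for idfun}}.
Hypothesis hip : forall u : H, `|u| ^+ 2 = ip u u.

(* Opial's argument: [|x - p|^2 - |x - q|^2] is affine in [x]. *)
Lemma weak_limit_unique {T : Type} (F U V : set_system T)
    {FF : Filter F} {UU : ProperFilter U} {VV : ProperFilter V}
    (x : T -> H) (p q : H) (lp lq : R) :
  F `<=` U -> F `<=` V ->
  `|x t - p| ^+ 2 @[t --> F] --> lp -> `|x t - q| ^+ 2 @[t --> F] --> lq ->
  (forall v, ip (x t) v @[t --> U] --> ip p v) ->
  (forall v, ip (x t) v @[t --> V] --> ip q v) -> p = q.
Proof.
move=> FU FV xp xq Up Vq; pose l := lq - lp + (`|p| ^+ 2 - `|q| ^+ 2).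
have lim : ip (x t) (p - q) * 2 @[t --> F] --> l.
  have -> : (fun t => ip (x t) (p - q) * 2) = (fun t =>
      `|x t - q| ^+ 2 - `|x t - p| ^+ 2 + (`|p| ^+ 2 - `|q| ^+ 2)).
    by apply/funext => t; rewrite !hip !ipE (ipC ip p (x t)) (ipC ip q (x t)); ring.
  by apply: cvgD; [exact: cvgB|exact: cvg_cst].
(* The limit [l] along [F] is inherited by [U] and [V], so [p] and [q] have the same inner product
   with [p - q]. *)
have pl : ip p (p - q) * 2 = l.
  have lU : ip (x t) (p - q) * 2 @[t --> U] --> l by move=> N /lim; exact: FU.
  by apply: cvg_unique lU => //; exact: cvgMr_tmp.
have ql : ip q (p - q) * 2 = l.
  have lV : ip (x t) (p - q) * 2 @[t --> V] --> l by move=> N /lim; exact: FV.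
  by apply: cvg_unique lV => //; exact: cvgMr_tmp.
apply/eqP; rewrite -subr_eq0 -normr_eq0 -sqrf_eq0 hip ipDl ipNl.
by apply/eqP; lra.
Qed.

End uniqueness.

(** * Weak convergence of both trajectories *)

Theorem theorem2 (R : realType) (H : completeNormedModType R)
  (ip : {dot H for idfun}) (hip : forall u : H, `|u| ^+ 2 = ip u u)
  (A : H -> set H) (hA : maximally_monotone_op ip A)
  (B : H -> H) (hB : monotone_op ip (op_of B))
  (beta : R) (hbeta : 0 < beta) (hBlip : (beta^-1).-lipschitz B)
  (hZer : Zer (op_add A (op_of B)) !=set0)
  (gamma dgamma : R -> R)
  (hgamma_range : forall t : R, 0 <= t -> 0 < gamma t < beta)
  (hgamma_ac : real_loc_abs_cont gamma dgamma)
  (delta epsilon : R) (hdelta : 0 < delta) (hepsilon : 0 < epsilon)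
  (hgamma_bound : forall t : R, 0 <= t -> delta <= gamma t <= beta - epsilon)
  (hdgamma : dgamma \_ `[0, +oo[ \in Lfun (@lebesgue_measure R) +oo%E)
  (x0 : H) (x dx z : R -> H) (hx_ac : loc_abs_cont x dx)
  (hz : forall t : R, 0 <= t ->
    resolvent (gamma t) A (x t - gamma t *: B (x t)) = [set z t])
  (hx : {ae (@lebesgue_measure R), forall t : R, 0 <= t ->
    0 = dx t + x t - z t - gamma t *: B (x t) + gamma t *: B (z t)})
  (hx0 : x 0 = x0) :
  exists p : H, [/\ Zer (op_add A (op_of B)) p,
    weakly_cvg_at_infty ip x p & weakly_cvg_at_infty ip z p].
Proof.
have [L dgammaL] := Lfun_oo_ae_bounded hdgamma.
have gamma_lip := real_loc_abs_cont_lipschitz hgamma_ac dgammaL.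
have z_res t : 0 <= t -> resolvent (gamma t) A (x t - gamma t *: B (x t)) (z t).
  by move=> t0; rewrite hz.
have dxE : {ae (@lebesgue_measure R), forall t, 0 <= t ->
    dx t = z t - x t + gamma t *: (B (x t) - B (z t))}.
  apply: (@filterS _ _ (ae_filter_ringOfSetsType lebesgue_measure)) hx => t hxt t0.
  apply/eqP; rewrite -subr_eq0; apply/eqP; rewrite [RHS](hxt t0).
  by rewrite scalerBr !opprD !opprK !addrA (addrAC (dx t)).
have [p0 /Zer_addP Ap0] := hZer.
have x_le t : 0 <= t -> `|x t| <= `|x 0 - p0| + `|p0|.
  move=> t0; rewrite -[x t](subrK p0) (le_trans (ler_normD _ _))// lerD2r.
  by apply: (distance_nonincreasing hip hA.1 hB hbeta hBlip hdelta hepsilon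
    hgamma_bound hx_ac z_res dxE Ap0); rewrite lexx.
have gap0 := gap_cvg0 hip hA.1 hB hbeta hBlip hdelta hepsilon hgamma_bound
  gamma_lip hx_ac z_res dxE Ap0.
have t_ge0 : \forall t \near +oo, 0 <= t :> R.
  by apply: nbhs_pinfty_ge; exact: num_real.
have cluster (U : set_system R) : UltraFilter U -> pinfty_nbhs R `<=` U ->
    exists2 p, A p (- B p) & forall v, ip (x t) v @[t --> U] --> ip p v.
  move=> UU inftyU.
  apply: (@ultra_weak_limit_zero _ _ _ hip _ _ _ hA hB hbeta hBlip _ U _ gamma x z
    delta (`|x 0 - p0| + `|p0|) hdelta).
  - by apply: inftyU; apply: filterS t_ge0 => t /hgamma_bound /andP[].
  - by apply: inftyU; exact: filterS t_ge0.
  - by apply: inftyU; exact: filterS t_ge0.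
  - by move=> N /gap0; exact: inftyU.
(* One ultrafilter fixes the candidate [p]; every other one is then compared with it. *)
have [U [UU inftyU]] := @ultraFilterLemma _ (pinfty_nbhs R) _.
have [p Ap xp] := cluster U UU inftyU.
have xwp : weakly_cvg_at_infty ip x p.
  move=> v; apply: cvg_ultra => V VV inftyV.
  have [q Aq xq] := cluster V VV inftyV.
  suff -> : p = q by exact: xq.
  have dist_cvg r (Ar : A r (- B r)) := distance_cvg hip hA.1 hB hbeta hBlip hdelta hepsilon
    hgamma_bound hx_ac z_res dxE Ar.
  have [lp [xlp _]] := dist_cvg p Ap.
  have [lq [xlq _]] := dist_cvg q Aq.
  exact: (weak_limit_unique hip inftyU inftyV xlp xlq xp xq).
exists p; split => //; first exact/Zer_addP.
move=> v.
(* The gap tends to 0 in norm, so [z] inherits the weak limit of [x]. *)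
have gapv : ip (x t - z t) v @[t --> +oo] --> ip 0 v.
  by apply: cvg_ipl => //; apply/norm_cvg0P.
have -> : (fun t => ip (z t) v) = (fun t => ip (x t) v - ip (x t - z t) v).
  by apply/funext => t; rewrite !ipE; ring.
rewrite -[ip p v]subr0 -(linear0l ip v); apply: cvgB => //; exact: xwp.
Qed.
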